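(* Let $\mathbb{X}$ be a finite abelian group of order $n\ge 2$. The automaton $\mathcal{A}_{\mathbb{X}}$ is reversible, and it is bireversible if and only if the order $n$ of $\mathbb{X}$ is odd.
   Context: An automaton over a finite alphabet $\mathsf{X}$ is a triple $\mathcal{A}=(Q,\lambda,\mu)$ with set of states $Q$, transition function $\lambda:Q\times\mathsf{X}\to Q$ and output function $\mu:Q\times\mathsf{X}\to\mathsf{X}$. It is permutational if for every $q\in Q$ the map $x\mapsto\mu(q,x)$ is a permutation of $\mathsf{X}$. The inverse of a permutational automaton $\mathcal{A}$ is the automaton $\mathcal{A}^{-1}=(Q,\bar\lambda,\bar\mu)$ over $\mathsf{X}$ where, for $q\in Q$ and $x\in\mathsf{X}$, $\bar\mu(q,x)=y$ is the unique letter with $\mu(q,y)=x$, and $\bar\lambda(q,x)=\lambda(q,y)$. The dual of a finite automaton $\mathcal{A}=(Q,\lambda,\mu)$ over $\mathsf{X}$ is the automaton $\partial\mathcal{A}=(\mathsf{X},\partial\lambda,\partial\mu)$ over the alphabet $Q$ with $\partial\lambda(x,q)=\mu(q,x)$ and $\partial\mu(x,q)=\lambda(q,x)$. A permutational automaton $\mathcal{A}$ is reversible if $\partial\mathcal{A}$ is permutational; a reversible automaton $\mathcal{A}$ is bireversible if the dual $\partial(\mathcal{A}^{-1})$ of its inverse is permutational. For an additively written finite abelian group $\mathbb{X}$ of order $n\ge2$, $\mathcal{A}_{\mathbb{X}}$ is the automaton over the alphabet $\mathbb{X}$ with set of states $Q_{\mathbb{X}}=\{a_i : i\in\mathbb{X}\}$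 (pairwise distinct states), $\lambda_{\mathbb{X}}(a_i,j)=a_{i-j}$ and $\mu_{\mathbb{X}}(a_i,j)=i+j$ for $i,j\in\mathbb{X}$. *)

(* Defs.v *)
From HB Require Import structures.
From mathcomp Require Import all_boot all_order all_algebra.

Set Implicit Arguments.
Unset Strict Implicit.
Unset Printing Implicit Defensive.

Import GRing.Theory.
Local Open Scope ring_scope.

Record automaton (Q : Type) (X : finType) := Automaton {
  trans : Q -> X -> Q;
  output : Q -> X -> X
}.

Definition permutational (Q : Type) (X : finType) (A : automaton Q X) : Prop :=
  forall q : Q, bijective (output A q).

(* [invF (bij_inj (pA q)) x] is the unique letter [y] with
   [output A q y = x]. *)
Definition inverse (Q : Type) (X : finType) (A : automaton Q X)
    (pA : permutational A) : automaton Q X :=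
  {| trans := fun q x => trans A q (invF (bij_inj (pA q)) x);
     output := fun q x => invF (bij_inj (pA q)) x |}.

Definition dual (Q X : finType) (A : automaton Q X) : automaton X Q :=
  {| trans := fun x q => output A q x;
     output := fun x q => trans A q x |}.

Definition reversible (Q X : finType) (A : automaton Q X) : Prop :=
  permutational A /\ permutational (dual A).

(* The inverse takes a proof of permutationality as an argument; its values do
   not depend on which proof is supplied. *)
Definition bireversible (Q X : finType) (A : automaton Q X) : Prop :=
  reversible A /\
  exists pA : permutational A, permutational (dual (inverse pA)).

(* The set of states {a_i : i in X}, a disjoint copy of the alphabet. *)
Record state (X : Type) := State { state_index : X }.

HB.instance Definition _ (X : Type) := [isNew for @state_index X].
HB.instance Definition _ (X : eqType) := [Equality of state X by <:].
HB.instance Definition _ (X : choiceType) := [Choice of state X by <:].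
HB.instance Definition _ (X : countType) := [Countable of state X by <:].
HB.instance Definition _ (X : finType) := [Finite of state X by <:].

Definition group_automaton (X : finZmodType) : automaton (state X) X :=
  {| trans := fun q j => let: State i := q in State (i - j);
     output := fun q j => let: State i := q in i + j |}.

(* Main.v *)
(** In the dual of the inverse automaton, the letter x maps the state a_i to
    a_(2i - x).  So bireversibility says that doubling is injective on X: when
    |X| is even, Cauchy's theorem gives an element of order 2; when |X| is odd,
    an element killed by both 2 and |X| is 0. *)

Require Import Defs.
From HB Require Import structures.
From mathcomp Require Import all_boot all_order all_algebra.
From mathcomp Require Import all_fingroup all_solvable.

Import GRing.Theory FinRing.Theory.
Local Open Scope ring_scope.

(** Lagrange's theorem in the group [[set: X]], whose powers are the multiples [*+]. *)
Lemma mulrn_card (X : finZmodType) (x : X) : x *+ #|X| = 0.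
Proof.
have xT : x \in [set: X]%G by rewrite inE.
by have := expg_cardG xT; rewrite zmodXgE cardsT.
Qed.

Lemma even_card_involution (X : finZmodType) :
  ~~ odd #|X| -> exists2 x : X, x != 0 & x *+ 2 = 0.
Proof.
move=> evX; have dv : (2 %| #|[set: X]%G|)%N by rewrite cardsT dvdn2.
have [x _ ox] := Cauchy (isT : prime 2) dv.
exists x; first by apply/eqP=> x0; move: ox; rewrite x0 order1.
by rewrite -zmodXgE -ox expg_order.
Qed.

Lemma double_injP (X : finZmodType) :
  injective (fun x : X => x *+ 2) <-> odd #|X|.
Proof.
split=> [inj2 | oX x y /eqP].
  apply/negPn/negP=> /even_card_involution[x /eqP x0 x2].
  by apply: x0; apply: inj2; rewrite mul0rn.
rewrite -subr_eq0 -mulrnBl => /eqP d2; apply/eqP; rewrite -subr_eq0.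
have := mulrn_card _ (x - y).
(* With [#|X|] = 1 + 2k and d = [x - y], 0 = [d *+ #|X|] = d + k(2d) = d. *)
rewrite -(odd_double_half #|X|) oX mulrnDr -mul2n mulrnA d2 mul0rn addr0.
by move/eqP.
Qed.

Lemma group_automaton_permutational (X : finZmodType) :
  permutational (group_automaton X).
Proof.
by case=> i; exists (fun x => x - i) => x /=; rewrite addrC ?addKr ?subrK.
Qed.

Lemma group_automaton_reversible (X : finZmodType) :
  reversible (group_automaton X).
Proof.
split; first exact: group_automaton_permutational.
move=> j; exists (fun q => let: State i := q in State (i + j)) => -[i] /=.
  by rewrite subrK.
by rewrite addrK.
Qed.

Lemma dual_inverse_output (X : finZmodType)
    (pA : permutational (group_automaton X)) (x i : X) :
  output (dual (inverse pA)) x (State i) = State (i *+ 2 - x).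
Proof.
have /= outK := f_invF (bij_inj (pA (State i))) x.
rewrite /=; set y := invF _ x in outK *.
(* Writing [x] as [i + y] gives 2i - x = i - y, the index reached from a_i by [y]. *)
by rewrite -outK mulr2n opprD addrA addrK.
Qed.

Theorem mainTheorem3 (X : finZmodType) (hX : (2 <= #|X|)%N) :
  reversible (group_automaton X) /\
  (bireversible (group_automaton X) <-> odd #|X|).
Proof.
split; first exact: group_automaton_reversible.
(* One letter suffices: the dual output at 0 sends a_i to a_(2i). *)
apply: iff_trans (double_injP X); split=> [[_ [pA /(_ 0) /bij_inj inj_out]] x y xy | inj2].
  suff [] : State x = State y by [].
  by apply: inj_out; rewrite !dual_inverse_output xy.
split; first exact: group_automaton_reversible.
(* The state set is finite, so injectivity suffices; the shift by [- x] cancels, leaving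
   doubling. *)
exists (group_automaton_permutational X) => x; apply: injF_bij => -[i] [j].
by rewrite !dual_inverse_output => -[/addIr/inj2->].
Qed.
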